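(* $${}_3F_2\left({\tfrac{1}{6},\tfrac{5}{6},\tfrac{1}{2}\atop 1,\tfrac{3}{2}};1\right)=\frac{3\sqrt{3}}{2\pi}\log(2+\sqrt{3}).$$
   Context: The generalized hypergeometric function is $${}_{3}F_2\left({a_1,a_2,a_{3}\atop b_1,b_2};x\right)=\sum_{n=0}^\infty\frac{(a_1)_n(a_2)_n(a_{3})_n}{(b_1)_n(b_2)_n}\frac{x^n}{n!},\qquad (\alpha)_n=\alpha(\alpha+1)\cdots(\alpha+n-1),\ (\alpha)_0=1.$$ At $x=1$ the series with the parameters in the claim converges. *)

(* Defs.v *)
From Stdlib Require Import Reals Factorial.
From Coquelicot Require Import Coquelicot.
Open Scope R_scope.

(** Rising factorial [(a)_n = a (a + 1) ... (a + n - 1)]. *)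
Fixpoint pochhammer (a : R) (n : nat) : R :=
  match n with
  | O => 1
  | S m => pochhammer a m * (a + INR m)
  end.

Definition hyp3F2_term (a1 a2 a3 b1 b2 x : R) (n : nat) : R :=
  (pochhammer a1 n * pochhammer a2 n * pochhammer a3 n)
    / (pochhammer b1 n * pochhammer b2 n)
  * (x ^ n / INR (fact n)).

(** [Series] is total, so a value of [hyp3F2] is meaningful only together with
    [ex_series] of its terms; [b1] and [b2] must avoid the nonpositive integers. *)
Definition hyp3F2 (a1 a2 a3 b1 b2 x : R) : R :=
  Series (hyp3F2_term a1 a2 a3 b1 b2 x).

(* Main.v *)
Require Import Defs.
From Stdlib Require Import Reals Factorial Lra Lia.
From Coquelicot Require Import Coquelicot.
Open Scope R_scope.

(** The expansion
      [sin (k x) = k * sum_n d_n * sin x ^ (2n+1)],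
      [d_n = ((1+k)/2)_n ((1-k)/2)_n / ((3/2)_n n!)],
    divided by [sin x] and integrated over [[0, PI/2]] with Wallis' integrals gives,
    for [k = 2/3], the value [3/PI * int_0^(PI/2) sin (2x/3) / sin x dx] of the series.
    With [u = x/3] the integrand is [2 cos u / (3 - 4 sin u ^ 2)], which has an
    elementary primitive.  Termwise integration is justified by bounding the
    remainder of the expansion after the term [n = N] by [e_(N+1) sin x], where
    [e_n = (2n+1) d_n <= (n+1)^(-1/2)]. *)

(** * Coefficients of the sine expansion and their decay *)

Lemma pochhammer_pos (a : R) (n : nat) : 0 < a -> 0 < pochhammer a n.
Proof.
  intros Ha. induction n as [|n IH]; simpl; [lra|].
  apply Rmult_lt_0_compat; [exact IH|]. pose proof (pos_INR n). lra.
Qed.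

Lemma pochhammer_1 (n : nat) : pochhammer 1 n = INR (fact n).
Proof.
  induction n as [|n IH]; [reflexivity|].
  change (pochhammer 1 n * (1 + INR n) = INR (S n * fact n)).
  rewrite mult_INR, S_INR, IH. ring.
Qed.

Definition sin_coef (k : R) (n : nat) : R :=
  pochhammer ((1 + k) / 2) n * pochhammer ((1 - k) / 2) n
    / (pochhammer (3 / 2) n * pochhammer 1 n).

(** The quotient of consecutive coefficients is ((1+k)/2 + n)((1-k)/2 + n) / ((3/2 + n)(1 + n));
    both products are scaled by 4. *)
Lemma sin_coef_S (k : R) (n : nat) :
  sin_coef k (S n) * ((2 * INR n + 3) * (2 * INR n + 2))
    = sin_coef k n * ((2 * INR n + 1) ^ 2 - k ^ 2).
Proof.
  unfold sin_coef; simpl pochhammer.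
  pose proof (pochhammer_pos (3 / 2) n ltac:(lra)).
  pose proof (pochhammer_pos 1 n ltac:(lra)).
  pose proof (pos_INR n).
  field. repeat split; lra.
Qed.

Lemma sin_coef_nonneg (k : R) (n : nat) : 0 <= k <= 1 -> 0 <= sin_coef k n.
Proof.
  intros Hk. induction n as [|n IH].
  - unfold sin_coef; simpl. lra.
  - pose proof (sin_coef_S k n) as E. pose proof (pos_INR n) as Hn.
    assert (0 <= sin_coef k n * ((2 * INR n + 1) ^ 2 - k ^ 2))
      by (apply Rmult_le_pos; [exact IH | nra]).
    apply Rmult_le_reg_r with ((2 * INR n + 3) * (2 * INR n + 2)); [nra|].
    lra.
Qed.

Definition sin_err (k : R) (n : nat) : R := (2 * INR n + 1) * sin_coef k n.

Lemma sin_err_nonneg (k : R) (n : nat) : 0 <= k <= 1 -> 0 <= sin_err k n.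
Proof.
  intros Hk. apply Rmult_le_pos; [pose proof (pos_INR n); lra|].
  now apply sin_coef_nonneg.
Qed.

(** By [sin_coef_S], e_(n+1) is e_n times ((2n+1)^2 - k^2) / ((2n+1)(2n+2)), a factor of at most (n
    + 1/2) / (n + 1). Squaring avoids square roots. *)
Lemma sin_err_sqr_le (k : R) (n : nat) :
  0 <= k <= 1 -> sin_err k n ^ 2 * (INR n + 1) <= 1.
Proof.
  intros Hk. induction n as [|n IH].
  - unfold sin_err, sin_coef; simpl. lra.
  - pose proof (pos_INR n) as Hn.
    pose proof (sin_err_nonneg k n Hk) as H0.
    pose proof (sin_err_nonneg k (S n) Hk) as H1.
    assert (E : sin_err k (S n) * (INR n + 1) <= sin_err k n * (INR n + 1 / 2)).
    { unfold sin_err. rewrite S_INR.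
      pose proof (sin_coef_S k n). pose proof (sin_coef_nonneg k n Hk). nra. }
    rewrite S_INR.
    assert (E2 : (sin_err k (S n) * (INR n + 1)) ^ 2 <= (sin_err k n * (INR n + 1 / 2)) ^ 2).
    { apply pow_incr; split; [nra | exact E]. }
    (* Two of the factors n + 1 serve [E2], the third serves [IH]; what remains is (n + 1/2)^2 (n +
       2) <= (n + 1)^3. *)
    apply Rmult_le_reg_r with ((INR n + 1) ^ 3); [apply pow_lt; lra|].
    replace (sin_err k (S n) ^ 2 * (INR n + 1 + 1) * (INR n + 1) ^ 3)
      with ((sin_err k (S n) * (INR n + 1)) ^ 2 * ((INR n + 2) * (INR n + 1))) by ring.
    apply Rle_trans with
      ((sin_err k n * (INR n + 1 / 2)) ^ 2 * ((INR n + 2) * (INR n + 1))).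
    { apply Rmult_le_compat_r; [nra | exact E2]. }
    replace ((sin_err k n * (INR n + 1 / 2)) ^ 2 * ((INR n + 2) * (INR n + 1)))
      with ((sin_err k n ^ 2 * (INR n + 1)) * ((INR n + 1 / 2) ^ 2 * (INR n + 2))) by ring.
    apply Rle_trans with (1 * ((INR n + 1 / 2) ^ 2 * (INR n + 2))).
    { apply Rmult_le_compat_r; [nra | exact IH]. }
    nra.
Qed.

Lemma is_lim_seq_sin_err (k : R) : 0 <= k <= 1 -> is_lim_seq (sin_err k) 0.
Proof.
  intros Hk. apply is_lim_seq_spec. intros eps. simpl.
  destruct (nfloor_ex (/ (eps * eps))) as [N [_ HN]].
  { left. apply Rinv_0_lt_compat. apply Rmult_lt_0_compat; apply cond_pos. }
  exists N. intros n Hn. apply le_INR in Hn.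
  pose proof (sin_err_nonneg k n Hk) as H0.
  rewrite Rminus_0_r, Rabs_pos_eq by exact H0.
  pose proof (sin_err_sqr_le k n Hk) as H1.
  pose proof (cond_pos eps) as He.
  assert (H2 : 1 < (eps * eps) * (INR n + 1)).
  { apply Rmult_lt_reg_l with (/ (eps * eps)).
    - apply Rinv_0_lt_compat. nra.
    - rewrite <- Rmult_assoc, Rinv_l by nra. lra. }
  destruct (Rlt_or_le (sin_err k n) eps) as [|H3]; [assumption|exfalso].
  pose proof (pos_INR n).
  assert (eps * eps <= sin_err k n ^ 2) by nra.
  nra.
Qed.

(** * Expansion of sin (k x) with remainder *)

(** Approximates sin (k x) / (k sin x), so that only even powers occur, as in Wallis' integrals. *)
Definition sin_partial (k : R) (N : nat) (x : R) : R :=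
  sum_n (fun n => sin_coef k n * sin x ^ (2 * n)) N.

(* Variation of constants: [D^2 + k^2] maps [sin t ^ (2n+1)] to
   [(2n+1) 2n sin t ^ (2n-1) - ((2n+1)^2 - k^2) sin t ^ (2n+1)], so the derivative
   of this sum in [t] telescopes.  It goes from [sin (k x)] at [t = 0] to
   [k sin x * sin_partial k N x] at [t = x]. *)
Definition sin_transport (k x : R) (N : nat) (t : R) : R :=
  sum_n (fun n => sin_coef k n *
    ((2 * INR n + 1) * sin t ^ (2 * n) * cos t * sin (k * (x - t))
     + k * sin t ^ (2 * n + 1) * cos (k * (x - t)))) N.

(** With f = sin t ^ (2n+1), a summand is d_n (f' sin (k (x-t)) + k f cos (k (x-t))) and has
    derivative d_n (f'' + k^2 f) sin (k (x-t)). By [sin_coef_S] neighbouring terms cancel, leaving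
    only the top power. *)
Lemma is_derive_sin_transport (k x t : R) (N : nat) :
  is_derive (sin_transport k x N) t
    (- (sin_err k (S N) * (2 * INR N + 2)) * sin t ^ (2 * N + 1) * sin (k * (x - t))).
Proof.
  assert (Hpyth : cos t * cos t = 1 - sin t * sin t)
    by (pose proof (sin2_cos2 t); unfold Rsqr in *; lra).
  assert (Hc : forall n, sin_err k (S n) * (2 * INR n + 2)
                 = sin_coef k n * ((2 * INR n + 1) ^ 2 - k ^ 2)).
  { intros n. rewrite <- sin_coef_S. unfold sin_err. rewrite S_INR. ring. }
  rewrite Hc.
  induction N as [|N IH].
  - apply (is_derive_ext (fun s => sin_coef k 0 *
      ((2 * INR 0 + 1) * sin s ^ (2 * 0) * cos s * sin (k * (x - s))
       + k * sin s ^ (2 * 0 + 1) * cos (k * (x - s))))).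
    { intros s. unfold sin_transport. now rewrite sum_O. }
    simpl. auto_derive; [exact I|].
    replace (x + - t) with (x - t) by ring.
    replace (1 + 1 - 1) with 1 by ring.
    ring_simplify.
    replace (cos t ^ 2) with (1 - sin t * sin t) by (rewrite <- Hpyth; ring). ring.
  - apply (is_derive_ext (fun s => sin_transport k x N s + sin_coef k (S N) *
      ((2 * INR (S N) + 1) * sin s ^ (2 * N + 2) * cos s * sin (k * (x - s))
       + k * sin s ^ (2 * N + 3) * cos (k * (x - s))))).
    { intros s. unfold sin_transport. rewrite sum_Sn. unfold plus; simpl AbelianMonoid.sort.
      replace (2 * S N)%nat with (2 * N + 2)%nat by lia.
      replace (2 * N + 2 + 1)%nat with (2 * N + 3)%nat by lia. reflexivity. }
    (* The surviving coefficient is expressed through d_(N+1), so that it cancels against the power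
       2N+1 of the new summand. *)
    rewrite <- Hc in IH. unfold sin_err in IH.
    replace (2 * S N + 1)%nat with (2 * N + 3)%nat by lia.
    evar_last.
    + apply (is_derive_plus (K := R_AbsRing) (V := R_NormedModule)); [exact IH|].
      auto_derive; [exact I|reflexivity].
    + unfold plus; simpl AbelianGroup.sort; simpl AbelianMonoid.sort; cbn -[INR pow Nat.mul sin_coef].
      change (N + (N + 0))%nat with (2 * N)%nat.
      change (match N with O => 1 | S _ => INR N + 1 end) with (INR (S N)).
      replace (x + - t) with (x - t) by ring.
      replace (Init.Nat.pred (2 * N + 2)) with (2 * N + 1)%nat by lia.
      replace (Init.Nat.pred (2 * N + 3)) with (2 * N + 2)%nat by lia.
      replace (2 * N + 3)%nat with (S (S (2 * N + 1))) by lia.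
      replace (2 * N + 2)%nat with (S (2 * N + 1)) by lia.
            rewrite !S_INR, plus_INR, mult_INR. simpl (INR 2). simpl (INR 1).
      rewrite <- !tech_pow_Rmult.
      set (p := sin t ^ (2 * N + 1)). set (m := INR N).
      generalize (sin_coef k (S N)). intros d.
      ring_simplify.
      replace (cos t ^ 2) with (1 - sin t * sin t) by (rewrite <- Hpyth; ring). ring.
Qed.

Lemma sin_transport_0 (k x : R) (N : nat) : sin_transport k x N 0 = sin (k * x).
Proof.
  unfold sin_transport. induction N as [|N IH].
  - rewrite sum_O. unfold sin_coef. simpl. rewrite sin_0, cos_0, Rminus_0_r. field.
  - rewrite sum_Sn, IH. unfold plus; simpl AbelianMonoid.sort.
    rewrite sin_0, !pow_i by lia. cbn -[INR sin cos]. ring.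
Qed.

Lemma sin_transport_diag (k x : R) (N : nat) :
  sin_transport k x N x = k * sin x * sin_partial k N x.
Proof.
  unfold sin_transport, sin_partial.
  rewrite <- (sum_n_mult_l (K := R_Ring) (k * sin x)).
  apply sum_n_ext. intros n. unfold mult; simpl Ring.sort.
  replace (k * (x - x)) with 0 by ring. rewrite sin_0, cos_0, pow_add.
  cbn -[INR sin pow Nat.mul]. ring.
Qed.

(** The difference is [sin_transport] at t = 0 minus its value at t = x, so both bounds follow from
    the sign of a derivative in t, by the mean value theorem. *)
Lemma sin_partial_bounds (k x : R) (N : nat) :
  0 <= k <= 1 -> 0 < x < PI / 2 ->
  0 <= sin (k * x) - k * sin x * sin_partial k N x <= sin_err k (S N) * sin x.
Proof.
  intros Hk Hx.
  set (c := sin_err k (S N)).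
  assert (Hc : 0 <= c) by (apply sin_err_nonneg; exact Hk).
  pose proof (pos_INR N) as HN.
  assert (Hs : forall t, 0 < t < x -> 0 <= sin t ^ (2 * N + 1)).
  { intros t Ht. apply pow_le, sin_ge_0; lra. }
  assert (Hk1 : forall t, 0 < t < x -> 0 <= sin (k * (x - t)) <= cos t).
  { intros t Ht. split.
    - apply sin_ge_0; nra.
    (* Here cos t = sin (PI/2 - t), and k (x - t) <= PI/2 - t since k <= 1 and x < PI/2. *)
    - rewrite cos_sin. rewrite <- (sin_PI_x (PI / 2 + t)).
      apply sin_incr_1; nra. }
  assert (HD := fun t => is_derive_sin_transport k x t N).
  fold c in HD. clearbody c.
  rewrite <- sin_transport_diag, <- (sin_transport_0 k x N).
  split.
  - destruct (MVT_cor2 (sin_transport k x N)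
      (fun t => - (c * (2 * INR N + 2)) * sin t ^ (2 * N + 1) * sin (k * (x - t))) 0 x)
      as [t [E Ht]]; [lra | |].
    { intros t _. apply is_derive_Reals, HD. }
    specialize (Hs t Ht). specialize (Hk1 t Ht).
    assert (0 <= (c * (2 * INR N + 2)) * sin t ^ (2 * N + 1) * sin (k * (x - t)) * (x - 0))
      by (repeat apply Rmult_le_pos; lra).
    lra.
  (* The added power has derivative c (2N+2) cos t sin t ^ (2N+1), which outweighs the negative one
     because sin (k (x-t)) <= cos t. *)
  - destruct (MVT_cor2 (fun t => sin_transport k x N t + c * sin t ^ (2 * N + 2))
      (fun t => - (c * (2 * INR N + 2)) * sin t ^ (2 * N + 1) * sin (k * (x - t))
                + c * ((2 * INR N + 2) * cos t * sin t ^ (2 * N + 1))) 0 x)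
      as [t [E Ht]]; [lra | |].
    { intros t _. apply is_derive_Reals.
      apply (is_derive_plus (K := R_AbsRing) (V := R_NormedModule)); [apply HD|].
      auto_derive; [exact I|].
      change (N + (N + 0))%nat with (2 * N)%nat.
      replace (Init.Nat.pred (2 * N + 2)) with (2 * N + 1)%nat by lia.
      rewrite plus_INR, mult_INR. simpl (INR 2). ring. }
    specialize (Hs t Ht). specialize (Hk1 t Ht).
    assert (0 <= (c * (2 * INR N + 2)) * sin t ^ (2 * N + 1) * (cos t - sin (k * (x - t)))
                 * (x - 0))
      by (repeat apply Rmult_le_pos; lra).
    rewrite sin_0, pow_i in E by lia.
    assert (Hsx : sin x ^ (2 * N + 2) <= sin x).
    { pose proof (sin_ge_0 x ltac:(lra) ltac:(lra)). pose proof (SIN_bound x).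
      replace (2 * N + 2)%nat with (S (2 * N + 1)) by lia.
      rewrite <- tech_pow_Rmult.
      assert (sin x ^ (2 * N + 1) <= 1).
      { rewrite <- (pow1 (2 * N + 1)). apply pow_incr; lra. }
      nra. }
    assert (c * sin x ^ (2 * N + 2) <= c * sin x) by (apply Rmult_le_compat_l; assumption).
    lra.
Qed.

(** * Wallis' integrals *)

(** The primitive of sin x ^ (2n) that vanishes at 0, from the reduction formula given by
    integration by parts. Explicit primitives stand in for integrals throughout. *)
Fixpoint wallis_prim (n : nat) (x : R) : R :=
  match n with
  | O => x
  | S m => ((2 * INR m + 1) * wallis_prim m x - cos x * sin x ^ (2 * m + 1))
             / (2 * INR m + 2)
  end.

Lemma is_derive_wallis_prim (n : nat) (x : R) :
  is_derive (wallis_prim n) x (sin x ^ (2 * n)).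
Proof.
  induction n as [|n IH].
  - simpl. apply (is_derive_id (K := R_AbsRing)).
  - cbn [wallis_prim].
    pose proof (pos_INR n).
    auto_derive.
    + exists (sin x ^ (2 * n)). exact IH.
    + change (fun x0 : R => wallis_prim n x0) with (wallis_prim n).
      rewrite (is_derive_unique (wallis_prim n) x _ IH).
      change (n + (n + 0))%nat with (2 * n)%nat.
      replace (Init.Nat.pred (2 * n + 1)) with (2 * n)%nat by lia.
      replace (2 * S n)%nat with (S (S (2 * n))) by lia.
      replace (2 * n + 1)%nat with (S (2 * n)) by lia.
      rewrite S_INR, mult_INR. simpl (INR 2). rewrite <- !tech_pow_Rmult.
      assert (Hpyth : cos x * cos x = 1 - sin x * sin x)
        by (pose proof (sin2_cos2 x); unfold Rsqr in *; lra).
      field_simplify; [|lra].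
      replace (cos x ^ 2) with (1 - sin x * sin x) by (rewrite <- Hpyth; ring).
      field. lra.
Qed.

Lemma wallis_prim_0 (n : nat) : wallis_prim n 0 = 0.
Proof.
  induction n as [|n IH]; cbn [wallis_prim]; [reflexivity|].
  rewrite IH, sin_0, pow_i by lia. unfold Rdiv. ring.
Qed.

(** At PI/2 the boundary term of the reduction formula vanishes, leaving the factor (2n+1)/(2n+2) =
    (1/2 + n)/(1 + n) at each step. *)
Lemma wallis_prim_PI2 (n : nat) :
  wallis_prim n (PI / 2) = PI / 2 * (pochhammer (1 / 2) n / pochhammer 1 n).
Proof.
  induction n as [|n IH]; cbn [wallis_prim pochhammer]; [field|].
  rewrite IH, cos_PI2.
  pose proof (pos_INR n). pose proof (pochhammer_pos 1 n ltac:(lra)).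
  field. lra.
Qed.

(** * Primitive of sin (2x/3) / sin x *)

(** With v = sin (x/3), this is the partial fraction primitive of 6 dv / (3 - 4 v^2). *)
Definition ratio_prim (x : R) : R :=
  sqrt 3 / 2 * (ln (sqrt 3 + 2 * sin (x / 3)) - ln (sqrt 3 - 2 * sin (x / 3))).

Lemma sqrt3_gt_1 : 1 < sqrt 3.
Proof. rewrite <- sqrt_1. apply sqrt_lt_1; lra. Qed.

Lemma sin_third_bounds (x : R) : 0 <= x <= PI / 2 -> 0 <= sin (x / 3) <= 1 / 2.
Proof.
  intros Hx. split; [apply sin_ge_0; lra|].
  rewrite <- sin_PI6. apply sin_incr_1; lra.
Qed.

(** The derivative is given in a form regular on the closed interval; sin (2x/3) / sin x is 0/0 at x
    = 0. *)
Lemma is_derive_ratio_prim (x : R) :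
  0 <= x <= PI / 2 ->
  is_derive ratio_prim x (2 * cos (x / 3) / (3 - 4 * sin (x / 3) ^ 2)).
Proof.
  intros Hx. unfold ratio_prim.
  pose proof (sin_third_bounds x Hx). pose proof sqrt3_gt_1.
  assert (H3 : sqrt 3 * sqrt 3 = 3) by (apply sqrt_sqrt; lra).
  auto_derive.
  - unfold Rdiv in *. repeat split; lra.
  - change (x * / 3) with (x / 3).
    replace (3 - 4 * sin (x / 3) ^ 2)
      with ((sqrt 3 + 2 * sin (x / 3)) * (sqrt 3 - 2 * sin (x / 3)))
      by lra.
    field_simplify_eq; [|lra].
    replace (sqrt 3 ^ 3) with (sqrt 3 * sqrt 3 * sqrt 3) by ring.
    replace (sqrt 3 ^ 2) with 3 by lra.
    rewrite H3. ring.
Qed.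

(** Double- and triple-angle formulas for u = x/3: sin 2u = 2 sin u cos u and sin 3u = sin u (3 - 4
    sin u ^ 2). *)
Lemma sin_two_thirds (x : R) :
  sin (2 / 3 * x) * (3 - 4 * sin (x / 3) ^ 2) = sin x * (2 * cos (x / 3)).
Proof.
  replace (2 / 3 * x) with (2 * (x / 3)) by field.
  replace (sin x) with (sin (2 * (x / 3) + x / 3)) by (f_equal; field).
  rewrite sin_plus, sin_2a, cos_2a_sin.
  pose proof (sin2_cos2 (x / 3)) as P; unfold Rsqr in P.
  set (s := sin (x / 3)) in *. set (c := cos (x / 3)) in *.
  replace (2 * s * c * (3 - 4 * s ^ 2))
    with (2 * c * s * (2 * 1 + (1 - 4 * s ^ 2))) by ring.
  rewrite <- P. replace (1 - 2 * s * s) with ((s * s + c * c) - 2 * s * s) by lra.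
  replace (1 - 4 * s ^ 2) with ((s * s + c * c) - 4 * s ^ 2) by lra. ring.
Qed.

Lemma ratio_prim_0 : ratio_prim 0 = 0.
Proof.
  unfold ratio_prim. replace (0 / 3) with 0 by field. rewrite sin_0.
  replace (sqrt 3 + 2 * 0) with (sqrt 3 - 2 * 0) by ring. ring.
Qed.

Lemma ratio_prim_PI2 : ratio_prim (PI / 2) = sqrt 3 / 2 * ln (2 + sqrt 3).
Proof.
  unfold ratio_prim. replace (PI / 2 / 3) with (PI / 6) by field. rewrite sin_PI6.
  pose proof sqrt3_gt_1.
  assert (H3 : sqrt 3 * sqrt 3 = 3) by (apply sqrt_sqrt; lra).
  (* Since (2 + sqrt 3)(sqrt 3 - 1) = sqrt 3 + 1, the difference of logarithms is ln (2 + sqrt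
     3). *)
  replace (sqrt 3 + 2 * (1 / 2)) with ((2 + sqrt 3) * (sqrt 3 - 2 * (1 / 2))).
  - rewrite ln_mult by lra. ring.
  - lra.
Qed.

(** * Termwise integration over [0, PI/2] *)

Lemma is_derive_wallis_sum (d : nat -> R) (N : nat) (x : R) :
  is_derive (fun y => sum_n (fun n => d n * wallis_prim n y) N) x
    (sum_n (fun n => d n * sin x ^ (2 * n)) N).
Proof.
  apply (is_derive_sum_n (K := R_AbsRing) (V := R_NormedModule)
           (fun n y => d n * wallis_prim n y) N x).
  intros n _. apply (is_derive_scal (wallis_prim n) x (d n)), is_derive_wallis_prim.
Qed.

(** The mean value theorem replaces integration: at its interior point sin x > 0, so
    [sin_partial_bounds] divided by sin x puts the derivative between 0 and e_(N+1). *)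
Lemma sum_wallis_bounds (N : nat) :
  0 <= ratio_prim (PI / 2)
       - 2 / 3 * sum_n (fun n => sin_coef (2 / 3) n * wallis_prim n (PI / 2)) N
    <= sin_err (2 / 3) (S N) * (PI / 2).
Proof.
  pose proof PI_RGT_0 as HPI.
  set (W := fun x => sum_n (fun n => sin_coef (2 / 3) n * wallis_prim n x) N).
  assert (HW0 : W 0 = 0).
  { unfold W. rewrite (sum_n_ext _ (fun _ => 0)).
    - rewrite sum_n_const. apply Rmult_0_r.
    - intros n. rewrite wallis_prim_0. apply Rmult_0_r. }
  destruct (MVT_cor2 (fun x => ratio_prim x - 2 / 3 * W x)
    (fun x => 2 * cos (x / 3) / (3 - 4 * sin (x / 3) ^ 2)
              - 2 / 3 * sin_partial (2 / 3) N x) 0 (PI / 2))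
    as [x [E Hx]]; [lra | |].
  { intros x Hx. apply is_derive_Reals.
    apply (is_derive_minus (K := R_AbsRing) (V := R_NormedModule)).
    - now apply is_derive_ratio_prim.
    - apply (is_derive_scal W x (2 / 3)), is_derive_wallis_sum. }
  change (0 <= ratio_prim (PI / 2) - 2 / 3 * W (PI / 2)
            <= sin_err (2 / 3) (S N) * (PI / 2)).
  rewrite ratio_prim_0, HW0 in E.
  replace (ratio_prim (PI / 2) - 2 / 3 * W (PI / 2))
    with (ratio_prim (PI / 2) - 2 / 3 * W (PI / 2) - (0 - 2 / 3 * 0)) by ring.
  rewrite E.
  pose proof (sin_partial_bounds (2 / 3) x N ltac:(lra) Hx) as B.
  pose proof (sin_gt_0 x ltac:(lra) ltac:(lra)) as Hs.
  pose proof (sin_third_bounds x ltac:(lra)) as Ht.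
  assert (E1 : 2 * cos (x / 3) / (3 - 4 * sin (x / 3) ^ 2) = sin (2 / 3 * x) / sin x).
  { pose proof (sin_two_thirds x) as T.
    assert (3 - 4 * sin (x / 3) ^ 2 <> 0) by nra.
    apply Rmult_eq_reg_r with (sin x * (3 - 4 * sin (x / 3) ^ 2)).
    - field_simplify; lra.
    - apply Rmult_integral_contrapositive; split; lra. }
  rewrite E1.
  set (D := sin (2 / 3 * x) / sin x - 2 / 3 * sin_partial (2 / 3) N x).
  assert (ED : D * sin x = sin (2 / 3 * x) - 2 / 3 * sin x * sin_partial (2 / 3) N x)
    by (unfold D; field; lra).
  rewrite <- ED in B.
  assert (0 <= D) by (apply Rmult_le_reg_r with (sin x); lra).
  assert (D <= sin_err (2 / 3) (S N)) by (apply Rmult_le_reg_r with (sin x); lra).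
  rewrite Rminus_0_r. split.
  - apply Rmult_le_pos; lra.
  - apply Rmult_le_compat_r; lra.
Qed.

(** * Summation of the hypergeometric series *)

(** For k = 2/3 the numbers (1 + k)/2 and (1 - k)/2 are 5/6 and 1/6; the Wallis value supplies
    (1/2)_n and a second (1)_n = n!. *)
Lemma hyp3F2_term_wallis (n : nat) :
  hyp3F2_term (1 / 6) (5 / 6) (1 / 2) 1 (3 / 2) 1 n
    = 2 / PI * (sin_coef (2 / 3) n * wallis_prim n (PI / 2)).
Proof.
  unfold hyp3F2_term, sin_coef.
  rewrite wallis_prim_PI2, <- pochhammer_1, pow1.
  replace ((1 + 2 / 3) / 2) with (5 / 6) by field.
  replace ((1 - 2 / 3) / 2) with (1 / 6) by field.
  pose proof (pochhammer_pos 1 n ltac:(lra)).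
  pose proof (pochhammer_pos (3 / 2) n ltac:(lra)).
  pose proof PI_RGT_0.
  field. lra.
Qed.

Lemma is_series_hyp3F2 :
  is_series (hyp3F2_term (1 / 6) (5 / 6) (1 / 2) 1 (3 / 2) 1)
    (3 * sqrt 3 / (2 * PI) * ln (2 + sqrt 3)).
Proof.
  pose proof PI_RGT_0 as HPI.
  set (L := 3 * sqrt 3 / (2 * PI) * ln (2 + sqrt 3)).
  assert (HL : L = 3 / PI * ratio_prim (PI / 2))
    by (rewrite ratio_prim_PI2; unfold L; field; lra).
  (* This is [sum_wallis_bounds] times 3/PI, which is 2/PI divided by k = 2/3; the factor 3/2 is
     3/PI times PI/2. *)
  assert (Hb : forall N,
    L - 3 / 2 * sin_err (2 / 3) (S N)
      <= sum_n (hyp3F2_term (1 / 6) (5 / 6) (1 / 2) 1 (3 / 2) 1) N <= L).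
  { intros N. pose proof (sum_wallis_bounds N) as B.
    rewrite (sum_n_ext _ _ N hyp3F2_term_wallis).
    rewrite (sum_n_mult_l (K := R_Ring) (2 / PI)
      (fun n => sin_coef (2 / 3) n * wallis_prim n (PI / 2))).
    rewrite HL.
    set (s := sum_n _ N) in *.
    change (mult (2 / PI) s) with (2 / PI * s).
    replace (2 / PI * s) with (3 / PI * (2 / 3 * s)) by (field; lra).
    replace (3 / 2 * sin_err (2 / 3) (S N))
      with (3 / PI * (sin_err (2 / 3) (S N) * (PI / 2))) by (field; lra).
    rewrite <- Rmult_minus_distr_l.
    assert (0 <= 3 / PI) by (apply Rlt_le, Rdiv_lt_0_compat; lra).
    split; apply Rmult_le_compat_l; lra. }
  apply (is_lim_seq_le_le _ _ (fun _ => L) L Hb).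
  - replace (Finite L) with (Finite (L - 3 / 2 * 0)) by (f_equal; ring).
    apply is_lim_seq_minus'; [apply is_lim_seq_const|].
    apply (is_lim_seq_scal_l (fun N => sin_err (2 / 3) (S N)) (3 / 2) 0).
    apply (is_lim_seq_incr_1 (sin_err (2 / 3))), is_lim_seq_sin_err. lra.
  - apply is_lim_seq_const.
Qed.

Theorem mainTheorem2 :
  ex_series (hyp3F2_term (1 / 6) (5 / 6) (1 / 2) 1 (3 / 2) 1) /\
  hyp3F2 (1 / 6) (5 / 6) (1 / 2) 1 (3 / 2) 1
    = 3 * sqrt 3 / (2 * PI) * ln (2 + sqrt 3).
Proof.
  split.
  - eexists. exact is_series_hyp3F2.
  - apply is_series_unique, is_series_hyp3F2.
Qed.
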